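(* Let $a\ge 0$, $b\ge 1$, $c\ge 1$ be integers and $n=a+b+c$. Let $G$ be the clique-clique-path graph obtained from a complete graph $K_{b+1}$ with two distinct chosen vertices $x,y$ by identifying $x$ with a vertex of a (disjoint) complete graph $K_c$ and attaching a pendant path of length $a$ at $y$ (so $G$ has $n$ vertices). Then \[ \frac{X_{G}}{(b-1)!\,(c-1)!}=\sum_{\substack{K\vDash n\\ k_{-1}\ge b+c}} b\, w_K\, e_K+\sum_{\substack{K\vDash n,\ \ell(K)\ge 2,\ k_{-1}+k_{-2}\ge b+c\\ k_{-1}\le \min(b-1,\,c-1)\ \text{or}\ k_{-1}\ge \max(b+1,\,c)}} \lvert b-k_{-1}\rvert\, w_{K\backslash k_{-1}}\, e_K, \] which is an expansion with nonnegative coefficients.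
   Context: All graphs are finite simple graphs. The chromatic symmetric function of a graph $G$ is $X_G=\sum_{\kappa}\prod_{v\in V(G)}x_{\kappa(v)}$, where $\kappa$ ranges over proper colorings $\kappa:V(G)\to\{1,2,\dots\}$. $e_k$ is the $k$-th elementary symmetric function. A composition $K=k_1\dotsm k_\ell$ of $n$ ($K\vDash n$) is a sequence of positive integers with sum $n$; $\ell(K)=\ell$; $k_{-1}=k_\ell$, $k_{-2}=k_{\ell-1}$, and $K\backslash k_{-1}=k_1\dotsm k_{\ell-1}$. Define $e_K=e_{k_1}\dotsm e_{k_\ell}$ and $w_K=k_1(k_2-1)\dotsm(k_\ell-1)$.
   Formalization: The second sum is further restricted to compositions with k_{-1} < b+c; as printed the formula double-counts and fails for every a ≥ 1 (e.g. a=b=c=1 gives 3e_3+2e_{21} instead of X_{P_3}=3e_3+e_{21}); for a=0 nothing changes. *)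

(* Defs.v *)
From mathcomp Require Import all_boot all_algebra.
From mathcomp.multinomials Require Import mpoly.
Set Implicit Arguments. Unset Strict Implicit. Unset Printing Implicit Defensive.
Import GRing.Theory.
Local Open Scope ring_scope.

(* Chromatic symmetric function of a graph with adjacency [adj] on 'I_n,
   restricted to the N variables x_0, ..., x_(N-1) (coefficients in rat):
   sum over proper colorings kappa : 'I_n -> 'I_N of prod_v x_(kappa v). *)
Definition proper_coloring (n N : nat) (adj : rel 'I_n) (kappa : {ffun 'I_n -> 'I_N}) : bool :=
  [forall u, forall v, adj u v ==> (kappa u != kappa v)].

Definition chromsym (n N : nat) (adj : rel 'I_n) : {mpoly rat[N]} :=
  \sum_(kappa : {ffun 'I_n -> 'I_N} | proper_coloring adj kappa) \prod_(v : 'I_n) 'X_(kappa v).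

(* The clique-clique-path graph on 'I_(a+b+c):
   - path vertices 0, 1, ..., a-1, with i ~ i+1 for i < a (so a-1 ~ a = y);
   - the clique K_(b+1) on the vertices a, ..., a+b  (y = a, x = a+b);
   - the clique K_c on the vertices a+b, ..., a+b+c-1 (sharing x = a+b). *)
Definition ccp_adj (a b c : nat) : rel 'I_(a + b + c) :=
  fun u v =>
    [&& (u != v) &
     [|| (a <= u <= a + b)%N && (a <= v <= a + b)%N
       , (a + b <= u)%N && (a + b <= v)%N
       | ((u.+1 == v :> nat) && (u < a)%N) || ((v.+1 == u :> nat) && (v < a)%N) ] ].

Definition is_composition (n : nat) (K : seq nat) : bool :=
  all (fun k => 0 < k)%N K && (sumn K == n).

Definition eK (N : nat) (K : seq nat) : {mpoly rat[N]} :=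
  \prod_(k <- K) mesym N rat k.

Definition wK (K : seq nat) : nat :=
  match K with
  | [::] => 1%N
  | k1 :: K' => (k1 * \prod_(k <- K') (k - 1))%N
  end.

Definition klast (K : seq nat) : nat := last 0%N K.
Definition kinit (K : seq nat) : seq nat := take (size K).-1 K.
Definition kpen (K : seq nat) : nat := nth 0%N K (size K).-2.

Definition absdiffn (m k : nat) : nat := ((m - k) + (k - m))%N.

(* Sum over all compositions K of n: a composition has length l <= n and parts
   in {0..n}; tuples of 'I_n.+1 of length l < n.+1 enumerate each exactly once. *)
Definition sum_comp (N n : nat) (P : seq nat -> bool) (F : seq nat -> {mpoly rat[N]})
  : {mpoly rat[N]} :=
  \sum_(l < n.+1) \sum_(t : l.-tuple 'I_n.+1 |
        is_composition n (map val t) && P (map val t)) F (map val t).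

Arguments ccp_adj a b c : clear implicits.
Arguments chromsym {n} N adj.
Arguments eK N K : clear implicits.
Arguments sum_comp N n P F : clear implicits.

(* Main.v *)
Require Import Defs.
From mathcomp Require Import all_boot all_algebra.
From mathcomp.multinomials Require Import mpoly.
From mathcomp Require Import zify ring.
Import GRing.Theory.
Local Open Scope ring_scope.
Set Implicit Arguments. Unset Strict Implicit. Unset Printing Implicit Defensive.

(* Color the two cut vertices y and x by j and i. Writing e_k(S) for the elementary
   symmetric polynomial in the variables of S, and P_a(j) for the weighted colorings of
   the path whose last vertex y is colored j,
     X_G = (b-1)! (c-1)! sum_j P_a(j) sum_(i <> j) x_i e_(c-1)(S-i) e_(b-1)(S-i-j).
   For fixed j the inner sum is a combination of products e_l(S) e_(b+c-1-l)(S-j):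
   moving one vertex from one clique to the other gives a recursion that telescopes.
   The coefficients are exactly |b - l| on the range of k_(-1) in the theorem (b for
   l = 0, and 0 elsewhere). What remains is sum_j P_a(j) e_q(S-j), a lollipop, equal to the sum of
   w_K e_K over the compositions K of a+q+1 with last part at least q+1; peeling off
   y gives the same recursion as splitting by whether that last part is q+1. Appending
   the part l to K then yields the second sum, while l = 0 yields the first. *)

(** * Elementary symmetric polynomials on variable subsets, and the rooted clique sum *)

Section Elementary.
Variables (R : comNzRingType) (I : finType) (x : I -> R).
Implicit Types (S : {set I}) (i j : I).

(** The variable set [S] is explicit so that the colors of the roots can be deleted from it. *)
Definition elsym S k : R :=
  \sum_(h : {set I} | (h \subset S) && (#|h| == k)) \prod_(i in h) x i.

Lemma elsym0 S : elsym S 0 = 1.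
Proof.
rewrite /elsym (big_pred1 set0) ?big_set0 // => h.
by rewrite cards_eq0 andbC /=; case: eqP => // ->; rewrite sub0set.
Qed.

Lemma elsym_in S i k : i \in S ->
  \sum_(h : {set I} | ((h \subset S) && (#|h| == k.+1)) && (i \in h))
    \prod_(j in h) x j = x i * elsym (S :\ i) k.
Proof.
move=> iS; rewrite /elsym big_distrr /=.
rewrite (reindex_onto (fun h => i |: h) (fun h => h :\ i)) /=; last first.
  by move=> h /andP[_ ih]; rewrite setD1K.
apply: eq_big => [h | h /andP[/andP[_ _] /eqP hE]].
  rewrite subUset sub1set iS setU11 subsetD1 andbT /=.
  case: (boolP (i \in h)) => ih.
    by rewrite andbF andbC eq_sym (negbTE (_ : h != _)) //; apply: contraTneq ih => ->; rewrite !inE eqxx.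
  by rewrite cardsU1 ih add1n eqSS setU1K // eqxx !andbT.
by rewrite big_setU1 //= -hE !inE eqxx.
Qed.

Lemma elsymD1 S i k : i \in S ->
  elsym S k.+1 = elsym (S :\ i) k.+1 + x i * elsym (S :\ i) k.
Proof.
move=> iS; rewrite -elsym_in // /elsym (bigID (fun h : {set I} => i \in h)) /= addrC.
by congr (_ + _); apply: eq_bigl => h; rewrite subsetD1 -!andbA; congr (_ && _); rewrite andbC.
Qed.

Lemma sum_elsym_in S k : \sum_(i in S) x i * elsym (S :\ i) k = k.+1%:R * elsym S k.+1.
Proof.
under eq_bigr => i iS do rewrite -elsym_in //.
rewrite (exchange_big_dep (fun h : {set I} => (h \subset S) && (#|h| == k.+1))) /=; last first.
  by move=> i h _ /andP[].
rewrite /elsym big_distrr /=; apply: eq_bigr => h /andP[hS /eqP hk].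
rewrite (eq_bigl (mem h)); last first.
  move=> i /=; rewrite hS hk eqxx /=.
  by case: (boolP (i \in h)) => ih; rewrite ?andbF // (subsetP hS).
by rewrite sumr_const hk mulr_natl.
Qed.

(** A [k]-subset of [S] is counted once for each of the [#|S| - k] elements outside it. *)
Lemma sum_elsym_out S k :
  \sum_(i in S) elsym (S :\ i) k = (#|S|%:R - k%:R) * elsym S k.
Proof.
case: k => [|k].
  by under eq_bigr => i _ do rewrite elsym0; rewrite sumr_const subr0 elsym0 mulr1.
have : \sum_(i in S) (elsym (S :\ i) k.+1 + x i * elsym (S :\ i) k) = #|S|%:R * elsym S k.+1.
  by under eq_bigr => i iS do rewrite -elsymD1 //; rewrite sumr_const mulr_natl.
by rewrite big_split /= sum_elsym_in mulrBl => <-; rewrite addrK.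
Qed.

(** Put [f k = elsym (S :\ j) k]. Expanding each [elsym S] by [elsymD1] turns both sides into the
    sum of [f l * f (n - l)] over [l <= s] plus [x j] times the sum of [f l * f (n - l - 1)] over
    [l < s]. *)
Lemma elsym_conv S j n s : j \in S -> (s <= n)%N ->
  \sum_(l < s.+1) elsym S l * elsym (S :\ j) (n - l)%N
  = \sum_(l < s) elsym S (n - l)%N * elsym (S :\ j) l + elsym (S :\ j) s * elsym (S :\ j) (n - s)%N.
Proof.
move=> jS; elim: s => [|s IH] lt_sn.
  by rewrite big_ord1 big_ord0 add0r !elsym0 !mul1r subn0.
rewrite big_ord_recr [in RHS]big_ord_recr /= IH ?(ltnW lt_sn) //.
have -> : (n - s = (n - s.+1).+1)%N by lia.
rewrite !(elsymD1 _ jS); ring.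
Qed.

(* The vertices [i] and [j] are the two roots of a clique on [g + 2] vertices; [i] lies
   in a further clique on [d + 1] vertices. *)
Definition rooted_cliques S j d g : R :=
  \sum_(i in S :\ j) x i * elsym (S :\ i) d * elsym (S :\ j :\ i) g.

(* Compare x_i e_g(S-i-j) = e_{g+1}(S-j) - e_{g+1}(S-i-j) with
   x_i e_d(S-i) = e_{d+1}(S) - e_{d+1}(S-i). *)
Lemma rooted_cliquesS S j d g : j \in S ->
  rooted_cliques S j d.+1 g = rooted_cliques S j d g.+1
    + (g.+2%:R - d.+1%:R) * elsym S d.+1 * elsym (S :\ j) g.+1
    - elsym (S :\ j) d.+1 * elsym (S :\ j) g.+1.
Proof.
move=> jS.
have out1 := sum_elsym_out S d.+1; have out2 := sum_elsym_out (S :\ j) g.+1.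
(* The term [i = j], absent from [rooted_cliques], is the source of the last product in the
   statement. *)
rewrite (big_setD1 j) //= in out1.
have cS : #|S|%:R = 1 + #|S :\ j|%:R :> R by rewrite (cardsD1 j S) jS natrD.
have : rooted_cliques S j d.+1 g - rooted_cliques S j d g.+1 =
  elsym (S :\ j) g.+1 * (\sum_(i in S :\ j) elsym (S :\ i) d.+1)
  - elsym S d.+1 * (\sum_(i in S :\ j) elsym (S :\ j :\ i) g.+1).
  rewrite !big_distrr /= /rooted_cliques -!sumrB; apply: eq_bigr => i iSj.
  have iS : i \in S by move: iSj; rewrite !inE => /andP[].
  rewrite (elsymD1 _ iSj) (elsymD1 _ iS); ring.
move/(canRL (subrK _)) => ->; rewrite out2.
move/(canRL (addKr _)): out1 => ->; rewrite cS -[d.+1]addn1 -[g.+2]addn1 !natrD; ring.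
Qed.

Lemma rooted_cliques_expand S j d g : j \in S ->
  rooted_cliques S j d g =
    \sum_(l < d.+1) (g.+1%:R - l%:R) * (elsym S l * elsym (S :\ j) ((d + g).+1 - l)%N)
  + \sum_(l < d.+1) (d%:R - l%:R) * (elsym S ((d + g).+1 - l)%N * elsym (S :\ j) l).
Proof.
move=> jS; elim: d g => [|d IH] g.
  rewrite !big_ord1 /= !subr0 mul0r addr0 subn0 add0n elsym0 mul1r -sum_elsym_in.
  by apply: eq_bigr => i _; rewrite elsym0 mulr1.
rewrite rooted_cliquesS // IH addSnnS.
have := @elsym_conv S j (d + g.+1).+1 d.+1 jS ltac:(lia).
have -> : ((d + g.+1).+1 - d.+1 = g.+1)%N by lia.
set A := (\sum_(l < d.+2) _) => conv.
(* The correction product involves only [S :\ j]. Rewritten this way, its negative lowers every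
   coefficient of the first sum by 1 and raises every coefficient of the second by 1, as the passage
   from [(d, g.+1)] to [(d.+1, g)] requires. *)
have {conv} -> : elsym (S :\ j) d.+1 * elsym (S :\ j) g.+1 = 
   A - \sum_(l < d.+1) elsym S ((d + g.+1).+1 - l)%N * elsym (S :\ j) l by rewrite conv; ring.
rewrite {}/A !(big_ord_recr d.+1) /= subrr mul0r addr0.
have -> : ((d + g.+1).+1 - d.+1 = g.+1)%N by lia.
have shift1 (m : R) (G : 'I_d.+1 -> R) : \sum_(l < d.+1) (m + 1 - l%:R) * G l =
   \sum_(l < d.+1) (m - l%:R) * G l + \sum_(l < d.+1) G l.
  by rewrite -big_split /=; apply: eq_bigr => l _; ring.
have natS k : k.+1%:R = k%:R + 1 :> R by rewrite natr1.
rewrite (natS g.+1) (natS d) !shift1 !natS; ring.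
Qed.
End Elementary.

(** * Sums over words: splitting and concatenation *)

Section TupleSums.
Variables (R : nmodType) (I : finType).
Implicit Types F : seq I -> R.

Lemma sum_tuple0 F : \sum_(t : 0.-tuple I) F t = F [::].
Proof.
rewrite (big_pred1 [tuple]) // => t; rewrite [t]tuple0.
by apply/esym/eqP.
Qed.

Lemma sum_tupleS n F :
  \sum_(t : n.+1.-tuple I) F t = \sum_i \sum_(t : n.-tuple I) F (i :: t).
Proof.
rewrite pair_big /=.
rewrite (reindex (fun p : I * n.-tuple I => cons_tuple p.1 p.2)) //=.
exists (fun t : n.+1.-tuple I => (thead t, [tuple of behead t])) => [[i t] _|t _] /=.
  by congr (_, _); apply: val_inj.
by rewrite [RHS]tuple_eta; apply: val_inj.
Qed.

Lemma sum_tupleD m n F :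
  \sum_(t : (m + n).-tuple I) F t
  = \sum_(u : m.-tuple I) \sum_(v : n.-tuple I) F (u ++ v).
Proof.
elim: m F => [|m IH] F.
  by rewrite (sum_tuple0 (fun u => \sum_(v : n.-tuple I) F (u ++ v))).
rewrite [LHS](@sum_tupleS (m + n)) (sum_tupleS _ (fun u => \sum_(v : n.-tuple I) F (u ++ v))).
by apply: eq_bigr => i _; rewrite (IH (fun u => F (i :: u))).
Qed.

Lemma sum_tuple_rcons n F :
  \sum_(t : n.+1.-tuple I) F t = \sum_(t : n.-tuple I) \sum_i F (rcons t i).
Proof.
rewrite -addn1 sum_tupleD; apply: eq_bigr => t _.
rewrite (sum_tupleS _ (fun v => F (t ++ v))); apply: eq_bigr => i _.
by rewrite (sum_tuple0 (fun v => F (t ++ i :: v))) cats1.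
Qed.
End TupleSums.

(** * Weighted injective words and weighted path colorings *)

Section Weights.
Variables (R : comNzRingType) (I : finType) (x : I -> R).
Implicit Types (S : {set I}) (i j : I).
Local Notation elsym := (elsym x).

Definition wt (s : seq I) : R := \prod_(i <- s) x i.

Lemma all_memD1 S i (s : seq I) : all (mem (S :\ i)) s = (i \notin s) && all (mem S) s.
Proof.
elim: s => //= h s IHs; rewrite IHs in_cons !inE eq_sym.
by case: (i == h); case: (h \in S); case: (i \in s).
Qed.

(** Each [k]-subset has [k!] orderings. In the induction the first letter [i] confines the tail to
    [S :\ i], and [sum_elsym_in] supplies the factor [k.+1]. *)
Lemma sum_uniq_tuple S k :
  \sum_(t : k.-tuple I) (uniq t && all (mem S) t)%:R * wt t = k`!%:R * elsym S k.
Proof.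
elim: k S => [|k IH] S.
  rewrite (sum_tuple0 (fun t => (uniq t && all (mem S) t)%:R * wt t)) /=.
  by rewrite /wt big_nil elsym0 fact0.
rewrite (sum_tupleS _ (fun t => (uniq t && all (mem S) t)%:R * wt t)) /=.
rewrite factS mulnC natrM -mulrA -sum_elsym_in big_distrr /= [RHS]big_mkcond /=.
apply: eq_bigr => i _; case: ifP => iS; last first.
  by apply: big1 => t _; rewrite andbF mul0r.
rewrite mulrCA -IH big_distrr /=; apply: eq_bigr => t _.
rewrite /wt big_cons mulrCA; congr (_ * (_%:R * _)).
by rewrite -andbA andbCA all_memD1.
Qed.

(* Weighted colorings of a path with [a] edges whose last vertex is colored [j]. *)
Fixpoint path_wt a j : R :=
  if a is a'.+1 then x j * (\sum_i path_wt a' i - path_wt a' j) else x j.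

Definition neqr : rel I := fun i j => i != j.

(** An arbitrary [g] makes the induction work: the sum over the last color is absorbed into a new
    function of the preceding color. *)
Lemma sum_path_tuple a (g : I -> R) :
  \sum_i0 \sum_(p : a.-tuple I) (path neqr i0 p)%:R * wt (i0 :: p) * g (last i0 p)
  = \sum_j path_wt a j * g j.
Proof.
elim: a g => [|a IH] g.
  apply: eq_bigr => i _.
  rewrite (sum_tuple0 (fun p => (path neqr i p)%:R * wt (i :: p) * g (last i p))) /=.
  by rewrite /wt big_seq1 mul1r.
transitivity (\sum_i0 \sum_(p : a.-tuple I) (path neqr i0 p)%:R * wt (i0 :: p)
     * (\sum_j (neqr (last i0 p) j)%:R * (x j * g j))).
  apply: eq_bigr => i _.
  rewrite (sum_tuple_rcons _ (fun p => (path neqr i p)%:R * wt (i :: p) * g (last i p))).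
  apply: eq_bigr => p _; rewrite big_distrr; apply: eq_bigr => j _ /=.
  rewrite rcons_path last_rcons -rcons_cons {1}/wt -cats1 big_cat big_seq1 /= -/(wt _).
  rewrite -mulnb natrM; ring.
rewrite (IH (fun i => \sum_j (neqr i j)%:R * (x j * g j))).
under eq_bigr do rewrite big_distrr /=.
rewrite exchange_big /=; apply: eq_bigr => j _.
rewrite [X in X - _](bigD1 j) //= addrAC subrr add0r -mulrA mulrCA mulrC big_distrl /=.
rewrite [RHS]big_mkcond; apply: eq_bigr => i _.
by rewrite /neqr; case: (i != j); rewrite ?mul0r ?mul1r ?mulr0.
Qed.
End Weights.

(** * Colorings as words, and factorization at the two cut vertices *)

Lemma sum_ffun_tuple (R : nmodType) (I : finType) n (F : {ffun 'I_n -> I} -> R) :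
  \sum_(f : {ffun 'I_n -> I}) F f = \sum_(t : n.-tuple I) F [ffun i => tnth t i].
Proof.
rewrite (reindex (fun t : n.-tuple I => [ffun i => tnth t i])) //=.
exists (fun f : {ffun 'I_n -> I} => [tuple f i | i < n]) => [t _|f _].
  by apply: eq_from_tnth => i; rewrite tnth_mktuple ffunE.
by apply/ffunP => i; rewrite ffunE tnth_mktuple.
Qed.

(** The vertex numbering makes the path and both cliques windows of the word; consecutive windows
    share the letters at [a] (vertex y) and [a + b] (vertex x). *)
Definition ccp_proper (I : finType) a b (s : seq I) :=
  [&& sorted (@neqr I) (take a.+1 s), uniq (take b.+1 (drop a s)) & uniq (drop (a + b) s)].

Lemma proper_coloring_ccp a b c N (x0 : 'I_N) (t : (a + b + c).-tuple 'I_N) :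
  proper_coloring (ccp_adj a b c) [ffun i => tnth t i] = ccp_proper a b t.
Proof.
have nthE (u : 'I_(a + b + c)) : tnth t u = nth x0 t u by rewrite (tnth_nth x0).
apply/forallP/and3P => [proper | [/(sortedP x0) path_t uniq_b uniq_c] u].
  have {}proper u v : (u < a + b + c)%N -> (v < a + b + c)%N -> u != v ->
      [|| (a <= u <= a + b)%N && (a <= v <= a + b)%N,
          (a + b <= u)%N && (a + b <= v)%N | (u.+1 == v) && (u < a)%N] ->
      nth x0 t u != nth x0 t v.
    move=> ltu ltv neq adj; have /forallP/(_ (Ordinal ltv))/implyP := proper (Ordinal ltu).
    rewrite !ffunE !nthE; apply; rewrite /ccp_adj /= -val_eqE /= neq.
    by case/or3P: adj => ->; rewrite ?orbT.
  split.
  - apply/(sortedP x0) => i; rewrite size_take_min size_tuple => lti.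
    rewrite !nth_take /neqr; try lia.
    apply: proper; lia.
  - apply/(uniqP x0) => i j; rewrite !inE !size_take_min !size_drop size_tuple => lti ltj.
    rewrite !nth_take ?nth_drop; try lia.
    move=> eq_ij; apply/eqP; apply: contra_eqT eq_ij => neq_ij; apply: proper; lia.
  apply/(uniqP x0) => i j; rewrite !inE !size_drop size_tuple => lti ltj.
  rewrite !nth_drop => eq_ij; apply/eqP; apply: contra_eqT eq_ij => neq_ij; apply: proper; lia.
apply/forallP => v; apply/implyP => /andP[neq adj]; rewrite !ffunE !nthE.
have {}neq : u != v :> nat by [].
have [ltu ltv] := (ltn_ord u, ltn_ord v).
case/or3P: adj => [/andP[ubnd vbnd] | /andP[ubnd vbnd] | ].
- have := @nth_uniq _ x0 (take b.+1 (drop a t)) (u - a) (v - a).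
  rewrite !size_take_min !size_drop size_tuple !nth_take ?nth_drop ?subnKC; try lia.
  by move=> -> //; lia.
- have := @nth_uniq _ x0 (drop (a + b) t) (u - (a + b)) (v - (a + b)).
  rewrite !size_drop size_tuple !nth_drop ?subnKC; try lia.
  by move=> -> //; lia.
have path_nat k : (k < a)%N -> (k.+1 < a + b + c)%N -> nth x0 t k != nth x0 t k.+1.
  move=> ka kn; have := path_t k; rewrite size_take_min size_tuple !nth_take; try lia.
  by apply; lia.
case/orP => /andP[/eqP eq_uv lt_a].
  by rewrite -eq_uv path_nat // eq_uv.
by rewrite eq_sym -eq_uv path_nat // eq_uv.
Qed.

(** Here [last i0 p] colors y and [i] colors x. Once both are fixed, the conditions on the remaining
    clique vertices [m] and [r] are independent, so the sum over words factors. *)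
Lemma ccp_proper_cat (I : finType) (i0 i : I) (p m r : seq I) :
  ccp_proper (size p) (size m).+1 ((i0 :: p) ++ m ++ i :: r)
  = path (@neqr I) i0 p && ((i \in [set: I] :\ last i0 p)
     && (uniq m && all (mem ([set: I] :\ last i0 p :\ i)) m)
     && (uniq r && all (mem ([set: I] :\ i)) r)).
Proof.
rewrite /ccp_proper take_size_cat //.
have -> : drop (size p) ((i0 :: p) ++ m ++ i :: r) = (last i0 p :: rcons m i) ++ r.
  by rewrite lastI -cats1 -!catA drop_size_cat ?size_belast // -cats1 /= -catA.
have -> : drop (size p + (size m).+1) ((i0 :: p) ++ m ++ i :: r) = i :: r.
  by rewrite catA drop_size_cat // size_cat addSnnS.
rewrite take_size_cat /= ?size_rcons // mem_rcons rcons_uniq !in_cons !inE negb_or !all_memD1.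
have allT (s : seq I) : all (mem [set: I]) s by apply/allP => y; rewrite inE.
rewrite !allT !andbT eq_sym; congr (_ && _).
by case: (i != _); case: (_ \in m); case: (_ \in m); case: (uniq m); case: (uniq r); case: (i \in r).
Qed.

(** With the shifted parameters, [b] and [c] count the non-root vertices of the two cliques; their
    orderings give the factorials. *)
Lemma chromsym_ccp a b c N :
  chromsym N (ccp_adj a b.+1 c.+1) = (b`! * c`!)%N%:R *
    \sum_(j : 'I_N) path_wt (fun i => 'X_i) a j
       * rooted_cliques (fun i => 'X_i : {mpoly rat[N]}) [set: 'I_N] j c b.
Proof.
set x := fun i : 'I_N => 'X_i : {mpoly rat[N]}.
pose F (s : seq 'I_N) := (ccp_proper a b.+1 s)%:R * wt x s.
transitivity (\sum_(t : (a + b.+1 + c.+1).-tuple 'I_N) F t).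
  rewrite /chromsym big_mkcond sum_ffun_tuple; apply: eq_bigr => t _.
  have lt0 : (0 < a + b.+1 + c.+1)%N by lia.
  rewrite (proper_coloring_ccp (tnth t (Ordinal lt0))) /F /wt.
  rewrite (big_tuple _ _ t xpredT) -mulrb mulr_natl; congr (_ *+ _).
  by apply: eq_bigr => v _; rewrite ffunE.
have -> : (a + b.+1 + c.+1 = a.+1 + (b + c.+1))%N by lia.
rewrite sum_tupleD (sum_tupleS _ (fun u => \sum_(v : (b + c.+1).-tuple 'I_N) F (u ++ v))).
pose g j : {mpoly rat[N]} := (b`! * c`!)%N%:R * rooted_cliques x [set: 'I_N] j c b.
transitivity (\sum_j path_wt x a j * g j); last first.
  by rewrite big_distrr; apply: eq_bigr => j _ /=; rewrite mulrCA.
rewrite -sum_path_tuple; apply: eq_bigr => i0 _; apply: eq_bigr => p _.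
rewrite (sum_tupleD _ _ (fun v => F ((i0 :: p) ++ v))).
under eq_bigr => m _ do rewrite (sum_tupleS _ (fun v => F ((i0 :: p) ++ m ++ v))).
rewrite exchange_big /g /rooted_cliques !big_distrr /= [RHS]big_mkcond; apply: eq_bigr => i _.
have wtE (m r : seq 'I_N) :
    wt x ((i0 :: p) ++ m ++ i :: r) = wt x (i0 :: p) * wt x m * x i * wt x r.
  by rewrite /wt !big_cat (big_cons _ _ i) /= !mulrA.
set Si := [set: _] :\ i; set Sl := [set: _] :\ last i0 p.
transitivity ((path (@neqr _) i0 p)%:R * wt x (i0 :: p) * (i \in Sl)%:R * x i *
   ((\sum_(m : b.-tuple 'I_N) (uniq m && all (mem (Sl :\ i)) m)%:R * wt x m) *
    (\sum_(r : c.-tuple 'I_N) (uniq r && all (mem Si) r)%:R * wt x r))).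
  rewrite big_distrlr big_distrr; apply: eq_bigr => m _ /=.
  rewrite big_distrr; apply: eq_bigr => r _ /=.
  rewrite /F -{1}(size_tuple p) -{1}(size_tuple m) ccp_proper_cat wtE -!mulnb !natrM; ring.
rewrite !sum_uniq_tuple natrM.
by case: (i \in Sl) => /=; rewrite ?mulr0 ?mulr1 ?mul0r //; ring.
Qed.

(** * The coefficients of the rooted clique sum *)

Definition ccp_coef b c k : nat :=
  if (k <= minn b.-1 c.-1)%N || (maxn b.+1 c <= k)%N then absdiffn b k else 0.

(** Reversing the second sum of [rooted_cliques_expand] aligns the products. The first sum
    contributes [b - l] when [l < c], the second [l - b] when [l >= b]: they cancel when both occur,
    and whichever occurs alone is nonnegative. *)
Lemma rooted_cliques_coef (R : comNzRingType) (I : finType) (x : I -> R) (S : {set I}) j b c :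
  j \in S -> (0 < b)%N -> (0 < c)%N ->
  rooted_cliques x S j c.-1 b.-1 =
    \sum_(l < b + c) (ccp_coef b c l)%:R * (elsym x S l * elsym x (S :\ j) ((b + c).-1 - l)%N).
Proof.
case: b c => [|g] // [|d] //= jS _ _; rewrite rooted_cliques_expand //.
have -> : (g.+1 + d.+1 = (d + g).+2)%N by lia.
have -> : (g + d.+1 = (d + g).+1)%N by lia.
set f := elsym x (S :\ j); set e := elsym x S; set n := (d + g).+1.
have le_dn : (d.+1 <= n.+1)%N by lia.
rewrite (big_ord_widen _ (fun l => (g.+1%:R - l%:R) * (e l * f (n - l)%N)) le_dn).
rewrite (big_ord_widen _ (fun l => (d%:R - l%:R) * (e (n - l)%N * f l)) le_dn).
rewrite [X in _ + X](reindex_inj rev_ord_inj) /= big_mkcond [X in _ + X]big_mkcond -big_split /=.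
apply: eq_bigr => l _; rewrite subSS; have ltl := ltn_ord l.
rewrite subKn; last by rewrite -ltnS.
have -> : (n - l)%:R = d%:R + g.+1%:R - l%:R :> R by rewrite -natrD addnS natrB // -ltnS.
rewrite /ccp_coef /absdiffn /=.
case: (ltnP l d.+1) => led; case: (ltnP (n - l)%N d.+1) => leg.
- rewrite ifF; last by lia.
  by ring.
- rewrite ifT; last by lia.
  rewrite natrD natrB; last by lia.
  have -> : (l - g.+1 = 0)%N by lia.
  by rewrite /=; ring.
- case: ifP => [_|].
    have -> : (g.+1 - l = 0)%N by lia.
    rewrite natrD natrB; last by lia.
    by rewrite /=; ring.
  (* The only index here outside the range of [ccp_coef] is [l = b], where [l - b] vanishes
     anyway. *)
  move=> lg; have -> : l = g.+1 :> nat by lia.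
  by ring.
rewrite ifF; last by lia.
by ring.
Qed.

(** * Weighted sums over compositions, and the lollipop identity *)

Section Compositions.
Variable N : nat.
Local Notation x := (fun i : 'I_N => 'X_i : {mpoly rat[N]}).

(** A duplicate-free list turns reindexing of [sum_comp] into a permutation argument. *)
Definition comps n : seq (seq nat) :=
  [seq map val (t : (l : 'I_n.+1).-tuple 'I_n.+1) | l <- enum 'I_n.+1,
     t <- [seq t : l.-tuple 'I_n.+1 <- enum {: l.-tuple 'I_n.+1} | is_composition n (map val t)]].

Lemma sum_compE n P F : sum_comp N n P F = \sum_(K <- comps n | P K) F K.
Proof.
rewrite /sum_comp /comps [RHS]big_mkcond big_allpairs_dep /= big_enum.
apply: eq_bigr => l _; rewrite big_filter big_enum_cond [RHS]big_mkcond [LHS]big_mkcond /=.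
by apply: eq_bigr => t _; case: (is_composition n _).
Qed.

Lemma composition_size n K : is_composition n K -> (size K <= n)%N.
Proof.
case/andP => pos /eqP <-; elim: K pos => //= k K IH /andP[k_gt0 /IH]; lia.
Qed.

Lemma composition_part n K k : is_composition n K -> k \in K -> (k <= n)%N.
Proof.
case/andP => _ /eqP <-; elim: K => //= k' K IH; rewrite inE => /orP[/eqP->|/IH]; lia.
Qed.

Lemma composition_rcons n K k :
  is_composition n (rcons K k) = [&& (0 < k)%N, (k <= n)%N & is_composition (n - k) K].
Proof.
rewrite /is_composition all_rcons sumn_rcons -!andbA; congr (_ && _).
case: (all _ _); lia.
Qed.

Lemma mem_comps n K : (K \in comps n) = is_composition n K.
Proof.
apply/allpairsPdep/idP => [[l [t [_ + ->]]] | cK].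
  by rewrite mem_filter => /andP[].
have szK : (size K < n.+1)%N by rewrite ltnS composition_size.
have eqK : map val [tuple of [seq (inord k : 'I_n.+1) | k <- in_tuple K]] = K.
  rewrite /= -map_comp -[RHS]map_id; apply/eq_in_map => k kK /=.
  by rewrite inordK // ltnS (composition_part cK).
exists (Ordinal szK), [tuple of [seq (inord k : 'I_n.+1) | k <- in_tuple K]].
by rewrite mem_enum mem_filter mem_enum eqK cK.
Qed.

Lemma comps_uniq n : uniq (comps n).
Proof.
apply: allpairs_uniq_dep => [|l _|[l t] [l' t'] _ _ /= eq_tt].
- exact: enum_uniq.
- exact/filter_uniq/enum_uniq.
have eq_l : l = l' by apply: val_inj; rewrite /= -(size_tuple t) -(size_tuple t') -!(size_map val) eq_tt.
by subst l'; congr existT; apply/val_inj/(inj_map val_inj).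
Qed.

Lemma sum_comp_rcons n P F : (0 < n)%N ->
  sum_comp N n P F = \sum_(1 <= k < n.+1)
    sum_comp N (n - k) (fun K => P (rcons K k)) (fun K => F (rcons K k)).
Proof.
move=> n_gt0; rewrite sum_compE.
under [RHS]eq_bigr do rewrite sum_compE.
have perm : perm_eq (comps n) [seq rcons K k | k <- index_iota 1 n.+1, K <- comps (n - k)].
  apply: uniq_perm; rewrite ?comps_uniq //.
    apply: allpairs_uniq_dep => [|k _|]; rewrite ?iota_uniq ?comps_uniq //.
    by move=> [k K] [k' K'] _ _ /= /rcons_inj[-> ->].
  move=> K; rewrite mem_comps; apply/idP/allpairsPdep => [|[k [K' [kn cK ->]]]].
    case/lastP: K => [|K k]; first by rewrite /is_composition /=; case: n n_gt0.
    rewrite composition_rcons => /and3P[k0 kn cK]; exists k, K.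
    by rewrite mem_index_iota mem_comps k0 ltnS.
  move: kn; rewrite mem_index_iota ltnS => /andP[k0 kn].
  by rewrite composition_rcons -mem_comps cK k0 kn.
by rewrite (perm_big _ perm) big_mkcond big_allpairs_dep /=; apply: eq_bigr => k _; rewrite [RHS]big_mkcond.
Qed.

Lemma sum_comp0 P F : sum_comp N 0 P F = if P [::] then F [::] else 0.
Proof.
have perm : perm_eq (comps 0) [:: [::]].
  apply: uniq_perm; rewrite ?comps_uniq // => K; rewrite mem_comps inE.
  by apply/idP/eqP => [/composition_size | -> //]; case: K.
rewrite sum_compE (perm_big _ perm) big_cons big_nil /=; case: ifP => // _; exact: addr0.
Qed.

Lemma eq_sum_comp n (P P' : seq nat -> bool) (F F' : seq nat -> {mpoly rat[N]}) :
  P =1 P' -> (forall K, P' K -> is_composition n K -> F K = F' K) ->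
  sum_comp N n P F = sum_comp N n P' F'.
Proof.
move=> eqPP eqF; apply: eq_bigr => l _.
apply: eq_big => [t|t /andP[cK PK]]; first by rewrite eqPP.
by rewrite eqF -?eqPP.
Qed.

Lemma sum_compZ n P F (y : {mpoly rat[N]}) :
  sum_comp N n P (fun K => y * F K) = y * sum_comp N n P F.
Proof.
by rewrite /sum_comp big_distrr /=; apply: eq_bigr => l _; rewrite big_distrr.
Qed.

Lemma eK_rcons K k : eK N (rcons K k) = elsym x setT k * eK N K.
Proof.
rewrite /eK -cats1 big_cat big_seq1 /= mulrC; congr (_ * _).
by apply: eq_bigl => h; rewrite subsetT.
Qed.

Lemma wK_rcons K k : wK (rcons K k) = if K is [::] then k else (wK K * k.-1)%N.
Proof.
case: K => [|k0 K] /=; first by rewrite big_nil muln1.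
by rewrite -cats1 big_cat big_seq1 /= mulnA subn1.
Qed.

(** The bound [r = 0] is no restriction; it admits even the empty composition, whose [klast] is
    0. *)
Definition wsum n r : {mpoly rat[N]} :=
  sum_comp N n (fun K => (r <= klast K)%N) (fun K => (wK K)%:R * eK N K).

(** Stripping the last part [k] costs a factor [k.-1], except when [k = n] is the only part: a first
    part has weight [k] itself. *)
Lemma wsum_expand n r : (0 < n)%N -> (0 < r)%N ->
  wsum n r = \sum_(r <= k < n.+1)
    (if k == n then n else k.-1)%:R * elsym x setT k * wsum (n - k) 0.
Proof.
move=> n_gt0 r_gt0; rewrite /wsum sum_comp_rcons // [RHS](big_nat_widenl _ 1) //.
rewrite [RHS]big_mkcond; apply: eq_big_nat => k /andP[k_gt0]; rewrite ltnS => le_kn.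
case: ifP => [/= le_rk | /= le_rk]; last first.
  rewrite /sum_comp; apply: big1 => l _; apply: big1 => t.
  by rewrite /klast last_rcons le_rk andbF.
rewrite -sum_compZ; apply: eq_sum_comp => [K|K _ cK].
  by rewrite /klast last_rcons le_rk.
rewrite eK_rcons wK_rcons; case: K cK => [|k0 K] cK.
  have {cK} : (n - k == 0)%N by case/andP: cK => _; rewrite eq_sym.
  move=> ?; have -> : k = n by lia.
  by rewrite eqxx /= mul1r mulrA.
rewrite ifF; last by apply: contraTF cK => /eqP ->; rewrite subnn; apply/negP => /composition_size.
rewrite natrM; ring.
Qed.

Lemma wsum1 n : (0 < n)%N -> wsum n 1 = wsum n 0.
Proof.
move=> n_gt0; rewrite /wsum !sum_comp_rcons //; apply: eq_big_nat => k /andP[k_gt0 _].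
by apply: eq_sum_comp => // K; rewrite /klast last_rcons k_gt0.
Qed.

Lemma wsumnn n : (0 < n)%N -> wsum n n = n%:R * elsym x setT n.
Proof.
move=> n_gt0; rewrite wsum_expand // big_nat1 eqxx subnn /wsum sum_comp0 /=.
by rewrite /eK big_nil !mulr1.
Qed.

Lemma wsum_rec n r : (0 < r < n)%N ->
  wsum n r = r.-1%:R * elsym x setT r * wsum (n - r) 0 + wsum n r.+1.
Proof.
case/andP => r_gt0 lt_rn; have n_gt0 := leq_ltn_trans (leq0n _) lt_rn.
by rewrite (@wsum_expand n r) // (@wsum_expand n r.+1) // big_ltn ?ltn_eqF // ltnS ltnW.
Qed.

(* The left-hand side is, up to the factor q!, the chromatic symmetric function of the
   lollipop obtained by gluing K_(q+1) to the end of a path with [a] edges. *)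
Lemma lollipop a q :
  \sum_j path_wt x a j * elsym x (setT :\ j) q = wsum (a + q).+1 q.+1.
Proof.
have sum_in k : \sum_j x j * elsym x (setT :\ j) k = k.+1%:R * elsym x setT k.+1.
  by rewrite -sum_elsym_in; apply: eq_bigl => j; rewrite inE.
elim: a q => [|a IH] q; first by rewrite wsumnn.
have IH0 : \sum_j path_wt x a j = wsum a.+1 0.
  rewrite -wsum1 // -[a in wsum a.+1](addn0 a) -IH.
  by apply: eq_bigr => j _; rewrite elsym0 mulr1.
rewrite wsum_rec; last by lia.
rewrite addSnnS -IH.
have -> : ((a + q.+1).+1 - q.+1 = a.+1)%N by lia.
rewrite -{}IH0.
have mulxE j : x j * elsym x (setT :\ j) q = elsym x setT q.+1 - elsym x (setT :\ j) q.+1.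
  by rewrite [elsym x setT _](elsymD1 _ _ (in_setT j)) addrAC subrr add0r.
(* The first sum gives [q.+1] copies of [elsym x setT q.+1] times the total path weight, and the
   second removes one, leaving the factor [q] of [wsum_rec]. What is left is the lollipop with a
   shorter path and a larger clique. *)
transitivity (\sum_j (x j * elsym x (setT :\ j) q) * (\sum_i path_wt x a i)
   - \sum_j path_wt x a j * (elsym x setT q.+1 - elsym x (setT :\ j) q.+1)).
  by rewrite -sumrB; apply: eq_bigr => j _; rewrite -mulxE /=; ring.
rewrite -big_distrl /= sum_in; under [X in _ - X]eq_bigr do rewrite mulrBr.
rewrite sumrB -big_distrl /= -natr1; ring.
Qed.

End Compositions.

(** * Matching the sum over [l] with the two composition sums *)

Theorem theorem5p4 (a b c : nat) (hb : (1 <= b)%N) (hc : (1 <= c)%N) (N : nat) :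
  ((((b.-1)`! * (c.-1)`!)%N%:R : rat)^-1 *: chromsym N (ccp_adj a b c))
  =
  sum_comp N (a + b + c)%N
    (fun K => (b + c <= klast K)%N)
    (fun K => (b * wK K)%N%:R * eK N K)
  +
  sum_comp N (a + b + c)%N
    (fun K => [&& (2 <= size K)%N, (b + c <= klast K + kpen K)%N, (klast K < b + c)%N &
                  (klast K <= minn b.-1 c.-1)%N || (maxn b.+1 c <= klast K)%N])
    (fun K => (absdiffn b (klast K) * wK (kinit K))%N%:R * eK N K).
Proof.
set x := fun i : 'I_N => 'X_i : {mpoly rat[N]}.
have chromE := chromsym_ccp a b.-1 c.-1 N.
rewrite !prednK // -/x in chromE.
rewrite chromE [_%:R * _]mulr_natl -scaler_nat scalerA mulVf ?scale1r; last first.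
  by rewrite Num.Theory.pnatr_eq0 muln_eq0 negb_or -!lt0n !fact_gt0.
under eq_bigr => j _ do rewrite rooted_cliques_coef // big_distrr /=.
rewrite exchange_big /=.
(* The lollipop has [q = b + c - 1 - l], hence [a + b + c - l] vertices and the bound [b + c - l] on
   the last part. *)
transitivity (\sum_(0 <= l < b + c) (ccp_coef b c l)%:R * elsym x setT l
    * wsum N (a + b + c - l) (b + c - l)).
  rewrite big_mkord; apply: eq_bigr => l _; have ltl := ltn_ord l.
  have -> : (b + c - l = ((b + c).-1 - l).+1)%N by lia.
  have -> : (a + b + c - l = (a + ((b + c).-1 - l)).+1)%N by lia.
  rewrite -lollipop big_distrr /=; apply: eq_bigr => j _; rewrite -/x; ring.
rewrite big_ltn; last by lia.
congr (_ + _).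
  rewrite elsym0 !subn0 mulr1 /wsum -sum_compZ.
  apply: eq_sum_comp => // K _ _.
  rewrite mulrA -natrM; congr (_%:R * _).
  by rewrite /ccp_coef /absdiffn sub0n addn0 subn0.
rewrite sum_comp_rcons; last by lia.
(* Last parts of size at least [b + c] contribute nothing, by the condition [klast K < b + c]. *)
rewrite [RHS](big_cat_nat _ (n := b + c)) /=; try lia.
rewrite [X in _ = _ + X]big1_seq ?addr0; last first.
  move=> k; rewrite mem_index_iota => /andP[_ /andP[le_k _]].
  rewrite /sum_comp; apply: big1 => l _; apply: big1 => t.
  by rewrite /klast last_rcons (ltnNge k) le_k /= !andbF.
apply: eq_big_nat => k /andP[k_gt0 lt_k].
rewrite /wsum /ccp_coef; case: ifP => cond; last first.
  rewrite !mul0r /sum_comp; apply/esym/big1 => l _; apply: big1 => t.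
  by rewrite /klast last_rcons cond !andbF.
rewrite -sum_compZ; apply: eq_sum_comp => [K | K _ _].
  rewrite size_rcons /klast last_rcons lt_k cond !andbT /kpen size_rcons /=.
  (* An empty remainder fails on both sides: the composition has only one part, and [klast [::] = 0]
     is below [b + c - k]. Otherwise the last part of the remainder is the penultimate part of the
     composition. *)
  case/lastP: K => [|K k'] /=; first by lia.
  by rewrite size_rcons nth_rcons size_rcons ltnSn nth_rcons ltnn eqxx last_rcons; lia.
rewrite eK_rcons /klast last_rcons /kinit size_rcons /= -cats1 take_size_cat // natrM -/x; ring.
Qed.
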